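(* Let $\psi:[1,\infty)\to(0,\infty)$ be continuous with $\inf_{p\ge 1}\psi(p)>0$, and let $\xi$ be a real random variable with $\xi\in G\psi$, $\xi\ne 0$; write $\|\xi\|=\|\xi\|G\psi\in(0,\infty)$. Put $\nu(p)=p\ln\psi(p)$ for $p\ge 1$ and $\nu^*(z)=\sup_{p\ge 1}\bigl(pz-\nu(p)\bigr)$. Then $$T_\xi(y)\le \exp\bigl\{-\nu^*\bigl[\ln(y/\|\xi\|)\bigr]\bigr\},\qquad y>e.$$
   Context: All random variables live on a probability space $(\Omega,F,\mathbf P)$ with expectation $\mathbf E$. For a random variable $\xi$, $T_\xi(y)=\mathbf P(|\xi|\ge y)$ for $y\ge 0$, and $|\xi|_p=(\mathbf E|\xi|^p)^{1/p}$ for $p\ge1$. For $\psi$ as in the claim, the Grand Lebesgue Space $G\psi$ consists of the random variables with finite norm $\|\xi\|G\psi=\sup_{p\in[1,\infty)}|\xi|_p/\psi(p)$. The statement $\xi\neq 0$ means that $\xi$ is not almost surely $0$. The function $\nu^*$ takes values in $(-\infty,+\infty]$, with $\exp(-\infty)=0$. *)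

(* Defs.v *)
From HB Require Import structures.
From mathcomp Require Import all_boot all_order all_algebra.
From mathcomp Require Import all_classical all_reals all_analysis.

Set Implicit Arguments.
Unset Strict Implicit.
Unset Printing Implicit Defensive.

Import Order.TTheory GRing.Theory Num.Theory.
Import numFieldNormedType.Exports.

Local Open Scope classical_set_scope.
Local Open Scope ring_scope.

(* The inequality in the event is non-strict, unlike in the library's [ccdf]. *)
Definition tail (d : measure_display) (T : measurableType d) (R : realType)
    (P : probability T R) (X : {RV P >-> R}) (y : R) : \bar R :=
  P [set w | y <= `|X w|].
Arguments tail {d T R} P X y.

(* Functions on [1, +oo) are represented by functions R -> R of which only the
   values on [1, +oo) are used. *)

Definition GLS_norm (d : measure_display) (T : measurableType d) (R : realType)
    (P : probability T R) (psi : R -> R) (X : {RV P >-> R}) : \bar R :=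
  ereal_sup [set ('N[P]_(p%:E)[EFin \o X] / (psi p)%:E)%E | p in `[1, +oo[].
Arguments GLS_norm {d T R} P psi X.

Definition GLS (d : measure_display) (T : measurableType d) (R : realType)
    (P : probability T R) (psi : R -> R) : set {RV P >-> R} :=
  [set X | (GLS_norm P psi X < +oo)%E].
Arguments GLS {d T R} P psi.

Definition nu (R : realType) (psi : R -> R) (p : R) : R := p * ln (psi p).

Definition nu_star (R : realType) (psi : R -> R) (z : R) : \bar R :=
  ereal_sup [set (p * z - nu psi p)%:E | p in `[1, +oo[].

(* Main.v *)
(** By Markov's inequality for [|xi|^p] and [|xi|_p <= ||xi|| psi(p)],
    [y^p T_xi(y) <= (||xi|| psi(p))^p] for every [p >= 1]. Taking logarithms,
    [-ln T_xi(y)] bounds every [p ln(y / ||xi||) - p ln psi(p)] from above,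
    hence also their supremum [nu^*(ln(y / ||xi||))]. *)

Require Import Defs.
From mathcomp Require Import all_boot all_order all_algebra.
From mathcomp Require Import all_classical all_reals all_analysis.
From mathcomp Require Import measurable_realfun lra.

Import Order.TTheory GRing.Theory Num.Theory.
Import numFieldNormedType.Exports.

Local Open Scope classical_set_scope.
Local Open Scope ring_scope.

Lemma tail_le_poweR_Lnorm (d : measure_display) (T : measurableType d)
    (R : realType) (P : probability T R) (X : {RV P >-> R}) (p y : R) :
  0 < p -> 0 < y ->
  ((y `^ p)%:E * tail P X y <= 'N[P]_(p%:E)[EFin \o X] `^ p)%E.
Proof.
move=> p0 y0; rewrite poweR_Lnorm ?gt_eqF// /tail.
have mX : measurable_fun [set: T] (EFin \o X) by exact/measurable_EFinP.
have := @le_integral_comp_abse _ _ _ P setT measurableT _ y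
  (fun x : \bar R => (x `^ p)%E) (measurable_poweR p)
  (fun x _ => poweR_ge0 x p) _ mX y0.
rewrite setTI; apply.
move=> a b; rewrite !inE/= !in_itv/= !andbT => a0 b0.
by apply: gt0_ler_poweR; rewrite ?in_itv/= ?leey ?a0 ?b0 ?ltW.
Qed.

Lemma Lnorm_le_GLS_norm (d : measure_display) (T : measurableType d)
    (R : realType) (P : probability T R) (psi : R -> R) (X : {RV P >-> R})
    (p : R) :
  1 <= p -> 0 < psi p ->
  ('N[P]_(p%:E)[EFin \o X] <= GLS_norm P psi X * (psi p)%:E)%E.
Proof.
move=> p1 psip0; rewrite -lee_pdivrMr//; apply: ereal_sup_ubound.
(* The inverse taken in the extended reals is the real inverse of [psi p] because [psi p] is
   nonzero. *)
by exists p; rewrite /= ?in_itv/= ?p1// inver gt_eqF.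
Qed.

(** The exponent 1 suffices: a nonpositive supremum forces the first absolute moment to vanish,
    hence [X = 0] almost everywhere. Positivity makes [ln] of the norm meaningful in the theorem. *)
Lemma GLS_norm_gt0 (d : measure_display) (T : measurableType d)
    (R : realType) (P : probability T R) (psi : R -> R) (X : {RV P >-> R}) :
  0 < psi 1 -> ~ {ae P, forall w, X w = 0} -> (0 < GLS_norm P psi X)%E.
Proof.
move=> psi1 X0; rewrite ltNge; apply/negP => N0; apply: X0.
have mX : measurable_fun [set: T] (EFin \o X) by exact/measurable_EFinP.
have L0 : ('N[P]_1%:E[EFin \o X] = 0)%E.
  apply/eqP; rewrite eq_le Lnorm_ge0 andbT.
  apply: le_trans (@Lnorm_le_GLS_norm _ _ _ P psi X 1 _ psi1) _ => //.
  by rewrite pmule_lle0 ?lte_fin.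
by apply: filterS (Lnorm_eq0_eq0 mX lte01 L0) => w /(_ I) [].
Qed.

Theorem theorem2p1 (d : measure_display) (T : measurableType d) (R : realType)
    (P : probability T R) (psi : R -> R) (xi : {RV P >-> R})
    (psi_gt0 : forall p : R, 1 <= p -> 0 < psi p)
    (psi_cont : {within `[1, +oo[, continuous psi})
    (psi_inf : 0 < inf [set psi p | p in `[1, +oo[])
    (xi_GLS : GLS P psi xi)
    (xi_neq0 : ~ {ae P, forall w, xi w = 0}) :
  forall y : R, expR 1 < y ->
    (tail P xi y <= expeR (- nu_star psi (ln (y / fine (GLS_norm P psi xi)))))%E.
Proof.
move=> y /(lt_trans (expR_gt0 _)) y0.
have N0 := @GLS_norm_gt0 _ _ _ P psi xi (psi_gt0 1 (lexx 1)) xi_neq0.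
have NE : GLS_norm P psi xi = (fine (GLS_norm P psi xi))%:E.
  by rewrite fineK// ge0_fin_numE// ltW.
set r := fine _ in NE *.
have r0 : 0 < r by rewrite -lte_fin -NE.
have tail_fin : tail P xi y \is a fin_num.
  apply: fin_num_measure; rewrite -[X in measurable X]setTI.
  have mxi : measurable_fun [set: T] (fun w => `|xi w|).
    exact: measurableT_comp.
  have := mxi measurableT _ (measurable_itv `[y, +oo[).
  by congr (measurable (_ `&` _)); apply/seteqP; split => w /=; rewrite in_itv/= andbT.
have tail_ge0 : (0 <= tail P xi y)%E by exact: measure_ge0.
have tailE := fineK tail_fin.
(* A zero tail is treated apart, since [ln 0] is only a default value; the bound then holds because
   [expeR] is nonnegative. *)
move: tail_ge0; rewrite -tailE lee_fin le_eqVlt => /predU1P[<-|t0].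
  exact: expeR_ge0.
(* With a positive tail, the claim becomes an upper bound on [nu_star] by the real number [- ln] of
   the tail, so the supremum is handled one [p] at a time. *)
rewrite -(lnK t0) -/(expeR (_%:E)) lee_expeR leeNr; apply/ereal_supP => _ [p + <-].
rewrite /= in_itv/= andbT => p1.
have p0 : 0 < p by exact: lt_le_trans p1.
have psip := psi_gt0 p p1.
have : (y `^ p * fine (tail P xi y) <= (r * psi p) `^ p)%R.
  rewrite -lee_fin EFinM tailE.
  apply: le_trans (@tail_le_poweR_Lnorm _ _ _ P xi p y p0 y0) _.
  rewrite -poweR_EFin; apply: gt0_ler_poweR.
  - exact: ltW.
  - by rewrite in_itv/= Lnorm_ge0 leey.
  - by rewrite in_itv/= leey andbT lee_fin ltW// mulr_gt0.
  - by rewrite EFinM -NE; exact: Lnorm_le_GLS_norm.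
rewrite -ler_ln ?posrE ?mulr_gt0 ?powR_gt0 ?mulr_gt0//.
rewrite lnM ?posrE ?powR_gt0// !ln_powR lnM ?posrE//.
rewrite lee_fin /nu ln_div ?posrE//.
(* Hypothesis and goal are now the same inequality, linear in the products of [p] with the
   logarithms of [y], [r] and [psi p]. *)
lra.
Qed.
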